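(* Fix a topological space $\underline{Z}$. The class $\mathbb{F}_0$ of $\equiv_0$-equivalence classes of functions $f:\underline{X}\to\underline{Z}$ ($\underline{X}$ ranging over all topological spaces), ordered by $\leq_0$, is a complete lattice: every subset has both a least upper bound and a greatest lower bound.
   Context: For functions $f:\underline{X}\to\underline{Z}$ and $g:\underline{Y}\to\underline{Z}$ between topological spaces, $f\leq_0 g$ means there is a continuous function $G:\underline{X}\to\underline{Y}$ with $f=g\circ G$; $f\equiv_0 g$ means $f\leq_0 g$ and $g\leq_0 f$. *)

(* Defs.v *)
From mathcomp Require Import all_boot all_classical topology.

Set Implicit Arguments.
Unset Strict Implicit.
Unset Printing Implicit Defensive.

Definition le0 (X Y Z : topologicalType) (f : X -> Z) (g : Y -> Z) : Prop :=
  exists2 G : X -> Y, continuous G & f = g \o G.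

Definition equiv0 (X Y Z : topologicalType) (f : X -> Z) (g : Y -> Z) : Prop :=
  le0 f g /\ le0 g f.

(* Functions need not be continuous, and [topologicalType] has no base point,
   so the empty space is one of the possible domains. *)
Record space_fun (Z : topologicalType) := SpaceFun {
  space : topologicalType;
  space_map :> space -> Z
}.

Definition equiv0_class (Z : topologicalType) (f : space_fun Z) :
    space_fun Z -> Prop :=
  fun g => equiv0 f g.

(* [space_fun Z] lives one universe above the carriers of topological spaces,
   which is too large for [eqType], [porderType] and [set]; hence the quotient
   as a type of equivalence classes, and subsets of it as bare predicates. *)
Record F0 (Z : topologicalType) := MkF0 {
  F0_mem :> space_fun Z -> Prop;
  F0_memP : exists f : space_fun Z, F0_mem = equiv0_class f
}.

Definition F0_pi (Z : topologicalType) (f : space_fun Z) : F0 Z :=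
  MkF0 (ex_intro _ f erefl).

Definition F0_le (Z : topologicalType) (a b : F0 Z) : Prop :=
  exists f g : space_fun Z, [/\ a f, b g & le0 f g].

Lemma le0_refl (X Z : topologicalType) (f : X -> Z) : le0 f f.
Proof. by exists id => // x; exact: cvg_id. Qed.

Lemma le0_trans (X Y W Z : topologicalType)
    (f : X -> Z) (g : Y -> Z) (h : W -> Z) : le0 f g -> le0 g h -> le0 f h.
Proof.
move=> [G cG ->] [H cH ->]; exists (H \o G) => // x.
by apply: continuous_comp; [exact: cG|exact: cH].
Qed.

Lemma F0_le_pi (Z : topologicalType) (f g : space_fun Z) :
  F0_le (F0_pi f) (F0_pi g) <-> le0 f g.
Proof.
split=> [[f' [g' [[ff' _] [_ g'g] f'g']]]|fg].
  exact: le0_trans ff' (le0_trans f'g' g'g).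
by exists f, g; split=> //; split; exact: le0_refl.
Qed.

Section CompleteLattice.
Variables (A : Type) (le : A -> A -> Prop).

Definition partial_order : Prop :=
  [/\ forall x, le x x,
      forall x y, le x y -> le y x -> x = y &
      forall x y z, le x y -> le y z -> le x z].

Definition is_upper_bound (S : A -> Prop) (u : A) : Prop :=
  forall x, S x -> le x u.

Definition is_lower_bound (S : A -> Prop) (l : A) : Prop :=
  forall x, S x -> le l x.

Definition is_lub (S : A -> Prop) (u : A) : Prop :=
  is_upper_bound S u /\ forall v, is_upper_bound S v -> le u v.

Definition is_glb (S : A -> Prop) (l : A) : Prop :=
  is_lower_bound S l /\ forall v, is_lower_bound S v -> le v l.

(* A predicate on a proper class such as [F0 Z] is a set, as opposed to a
   proper subclass, when it is the range of a family indexed by a type in the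
   universe of the carriers of topological spaces. *)
Definition is_small (S : A -> Prop) : Prop :=
  exists (I : Type@{Topological.axioms_.u0}) (F : I -> A),
    forall x, S x <-> exists i, F i = x.

Definition complete_lattice : Prop :=
  partial_order /\
  forall S : A -> Prop, is_small S ->
    (exists u, is_lub S u) /\ (exists l, is_glb S l).

End CompleteLattice.

(* Main.v *)
Require Import Defs.
From mathcomp Require Import all_boot all_classical topology.

(** The supremum of a family [f i : X i -> Z] is the map induced on the disjoint
    union of the [X i].  Its infimum is the map [(z, x) |-> z] on the generalized
    fibre product of all [(z, x)] with [f i (x i) = z] for every [i], where the
    coordinate [z] plays no part in the topology: the maps into [Z] are not
    assumed continuous.  Keeping [z] matters only for the empty family, whose
    infimum is the identity on [Z] with the indiscrete topology. *)

Set Implicit Arguments.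
Unset Strict Implicit.
Unset Printing Implicit Defensive.

Section Coproduct.
Variables (Z : topologicalType) (I : Type@{Topological.axioms_.u0}).
Variable f : I -> space_fun Z.

(** Since [I] lies in the universe of carriers, the disjoint union is again a carrier; [{classic I}]
    equips the indices with a classical choice structure. *)
Definition coproduct_space : topologicalType :=
  {i : {classic I} & space (f i)}.

Definition coproduct_fun : space_fun Z :=
  @SpaceFun Z coproduct_space (fun p => f (projT1 p) (projT2 p)).

Lemma le0_coproduct (i : I) : le0 (f i) coproduct_fun.
Proof.
exists (existT (fun j : {classic I} => space (f j)) i) => //.
exact: existT_continuous.
Qed.

Lemma coproduct_le0 (Y : topologicalType) (g : Y -> Z) :
  (forall i, le0 (f i) g) -> le0 coproduct_fun g.
Proof.
move=> fg.
pose G i := projT1 (cid2 (fg i)).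
exists (fun p : coproduct_space => G (projT1 p) (projT2 p)).
  apply: (@sigT_continuous {classic I} (fun i => space (f i)) Y G) => i.
  by rewrite /G; case: cid2.
apply: funext => -[i x] /=.
by rewrite /G; case: cid2 => /= H _ ->.
Qed.

End Coproduct.

Section FibreProduct.
Variables (Z : topologicalType) (I : Type@{Topological.axioms_.u0}).
Variable f : I -> space_fun Z.

Definition fibre_product : Type :=
  {classic {p : Z * prod_topology (fun i => space (f i)) |
             forall i, f i (p.2 i) = p.1}}.

Definition fibre_coords (p : fibre_product) :
  prod_topology (fun i => space (f i)) := (sval p).2.

Definition fibre_product_space : topologicalType :=
  initial_topology fibre_coords.

Definition fibre_product_fun : space_fun Z :=
  @SpaceFun Z fibre_product_space (fun p => (sval p).1).

Lemma fibre_product_le0 (i : I) : le0 fibre_product_fun (f i).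
Proof.
exists (fun p : fibre_product_space => fibre_coords p i); last first.
  by apply: funext => -[p fp] /=; rewrite -(fp i).
move=> p; apply: (@continuous_comp fibre_product_space
  (prod_topology (fun i => space (f i))) _ fibre_coords (fun x => x i)).
  exact: initial_continuous.
exact: (@proj_continuous {classic I} (fun i => space (f i)) i).
Qed.

(** The factors [G i] all lie over the common value [g y], which serves as the first coordinate even
    when [I] is empty. Continuity into the initial topology only concerns [fibre_coords]. *)
Lemma le0_fibre_product (Y : topologicalType) (g : Y -> Z) :
  (forall i, le0 g (f i)) -> le0 g fibre_product_fun.
Proof.
move=> gf.
pose G i := projT1 (cid2 (gf i)).
have GE y i : f i (G i y) = g y.
  by rewrite /G; case: cid2 => /= H _ ->.
exists (fun y => exist _ (g y, fun i => G i y) (GE y) : fibre_product_space) => //.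
apply: continuous_comp_initial => y.
(* The product topology is the supremum of the initial topologies of the projections, so one
   coordinate is checked at a time. *)
apply/cvg_sup => i.
apply: (@continuous_comp_initial _ _ _
  (fun x : prod_topology (fun i => space (f i)) => x i)
  (fun y i => G i y)).
by move=> {}y; rewrite /comp /= /G; case: cid2.
Qed.

End FibreProduct.

(** Extensionality identifies the two predicates, and proof irrelevance the two proofs of
    [F0_memP]. *)
Lemma F0_eq (Z : topologicalType) (a b : F0 Z) :
  (forall f, a f <-> b f) -> a = b.
Proof.
case: a b => [A hA] [B hB] /= AB.
have E : A = B by apply: funext => f; exact: propext.
by case: _ / E hB {AB} => hB; congr MkF0; exact: Prop_irrelevance.
Qed.

Lemma F0_pi_surj (Z : topologicalType) (a : F0 Z) : exists f, a = F0_pi f.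
Proof. by case: (F0_memP a) => f af; exists f; apply: F0_eq => g; rewrite af. Qed.

Lemma F0_le_partial_order (Z : topologicalType) : partial_order (@F0_le Z).
Proof.
split.
- by move=> a; have [f ->] := F0_pi_surj a; apply/F0_le_pi; exact: le0_refl.
- move=> a b; have [f ->] := F0_pi_surj a; have [g ->] := F0_pi_surj b.
  move=> /F0_le_pi fg /F0_le_pi gf; apply: F0_eq => h.
  by split=> -[? ?]; split; eauto using le0_trans.
- move=> a b c; have [f ->] := F0_pi_surj a; have [g ->] := F0_pi_surj b.
  have [h ->] := F0_pi_surj c.
  by move=> /F0_le_pi fg /F0_le_pi gh; apply/F0_le_pi; exact: le0_trans gh.
Qed.

Theorem theorem4p16 (Z : topologicalType) : complete_lattice (@F0_le Z).
Proof.
split; first exact: F0_le_partial_order.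
(* Smallness presents [S] as a family of classes; choosing a representative of each reduces both
   bounds to the constructions on functions. *)
move=> S [I [F SF]]; have [f Ff] := choice (fun i => F0_pi_surj (F i)).
have Sf i : S (F0_pi (f i)) by apply/SF; exists i; rewrite Ff.
split.
- exists (F0_pi (coproduct_fun f)); split=> [a /SF[i <-]|v].
    by rewrite Ff; apply/F0_le_pi; exact: le0_coproduct.
  have [g ->] := F0_pi_surj v => ub; apply/F0_le_pi/coproduct_le0 => i.
  exact/F0_le_pi/ub.
- exists (F0_pi (fibre_product_fun f)); split=> [a /SF[i <-]|v].
    by rewrite Ff; apply/F0_le_pi; exact: fibre_product_le0.
  have [g ->] := F0_pi_surj v => lb; apply/F0_le_pi/le0_fibre_product => i.
  exact/F0_le_pi/lb.
Qed.
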